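(* Let $K=\varphi(Y)^T\varphi(Y)\in\mathbb{R}^{N\times N}$ be a kernel (Gram) matrix, symmetric and positive semidefinite, let $K^\dagger$ denote its Moore–Penrose pseudoinverse, and denote $H_K=KK^\dagger=K^\dagger K$ (since $K$ is symmetric). Let $R\in\mathbb{R}^{N\times N}$, $\lambda\in\mathbb{R}^N$ with $\lambda\ge0$, $\nu\in\mathbb{R}$ and $\alpha,\beta\ge0$. Consider the sub-problem $$\min_{a\in\mathbb{R}^N:\ \|K^{1/2}a\|=1,\ \ x=bK,\ b\in\mathbb{R}^{1\times N}}\ \frac12\|x\|^2-x\,(R^TKa+\nu\lambda)+\beta\|x\|+\alpha\|x\|_1 .$$ Then the solution of this sub-problem is the following: $(d^+,\tau_1(d^+),\tau_2(d^+))$ is the solution of the min-max problem $$\min_{\|d\|=1}\ \max_{\|\tau_2\|_2\le1,\ \|\tau_1\|_\infty\le1}\ -\frac12\|R^TK^{1/2}d+\nu\lambda-\alpha\tau_1-\beta\tau_2\|_{H_K}^2,$$ and $$a^+=K^{-1/2}d^+,\qquad b^+=\bigl(R^TK^{1/2}d^++\nu\lambda-\beta\tau_2(d^+)-\alpha\tau_1(d^+)\bigr)^TK^\dagger .$$ As a consequence, the optimal $x$ is $$x^+=b^+K=\bigl(R^TK^{1/2}d^++\nu\lambda-\beta\tau_2(d^+)-\alpha\tau_1(d^+)\bigr)^TH_K .$$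
   Context: $\|\cdot\|$, $\|\cdot\|_2$ denote the Euclidean norm, $\|\cdot\|_1$ and $\|\cdot\|_\infty$ the $\ell_1$ and $\ell_\infty$ vector norms, and $\|v\|_H^2=v^THv$ for a symmetric positive semidefinite matrix $H$. Here $d,\tau_1,\tau_2\in\mathbb{R}^N$. With the eigendecomposition $K=U\Lambda U^T$ ($\Lambda$ diagonal), $K^{1/2}=U\Lambda^{1/2}U^T$ and $K^{-1/2}=U\Lambda^{-1/2}U^T$; the expression $K^{-1/2}$ is used as written, with no separate invertibility hypothesis on $K$ stated. A solution $(d^+,\tau_1(d^+),\tau_2(d^+))$ of the min-max problem means: $d^+$ minimizes over the unit sphere the value of the inner maximum, and $(\tau_1(d^+),\tau_2(d^+))$ attains the inner maximum at $d=d^+$. Background: this is one K-SVD-type step for the kernel dictionary pair learning / one-class SVM (OC-SVM) objective $\frac12\|\varphi(Y)(I-ABK)\|_F^2+\beta\sum_i\|b^iK\|_2+\sum_i\alpha_i\|b^iK\|_1+G(BK,\omega,\rho,\xi)$, where $\varphi$ is a feature map applied to the columns of the data matrix $Y$ (with $N$ columns), $G$ is the OC-SVM objective in Lagrangian form with hyperplane $(\omega,\rho)$ and slack variables $\xi$, $a=a_i$ is a column of $A$ normalized by $a_i^TKa_i=1$, $b=b^i$ is the corresponding row of $B$, $\alpha=\alpha_i$, $R=I-\sum_{j\ne i}a_jb^jK$ is the residual without the $i$-th pair, $\nu=\omega_i$ is the component of the OC-SVM normal vector $\omega$ corresponding to atom $i$, and $\lambda$ is the vector of OC-SVM Lagrange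 multipliers.
   Formalization: For singular K, K^{-1/2} is the pseudoinverse root and the formulas are claimed only for min-max solutions with d^+ in the range of K^{1/2}, since otherwise a^+ violates ||K^{1/2}a||=1 (K=diag(1,0), R=0, d^+=e_2); such a solution is shown to exist when K is nonzero. *)

(* Defs.v *)
From mathcomp Require Import all_boot all_order all_algebra.
From mathcomp Require Import all_classical all_reals all_analysis.

Set Implicit Arguments.
Unset Strict Implicit.
Unset Printing Implicit Defensive.

Import Order.TTheory GRing.Theory Num.Theory.
Import numFieldNormedType.Exports.

Local Open Scope classical_set_scope.
Local Open Scope ring_scope.

Section Norms.
Variable R : realType.

(* For row and column vectors; the l_infinity norm is MathComp-Analysis' own
   norm `|v| on matrices (the maximum of the absolute values of the entries). *)
Definition l2norm p q (v : 'M[R]_(p, q)) : R :=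
  Num.sqrt (\sum_i \sum_j v i j ^+ 2).

Definition l1norm p q (v : 'M[R]_(p, q)) : R := \sum_i \sum_j `|v i j|.

Definition sqnorm_wrt N (H : 'M[R]_N) (v : 'cV[R]_N) : R := (v^T *m H *m v) 0 0.

End Norms.

Section Matrices.
Variable R : realType.

(* phi(Y)^T phi(Y), where phi(Y) is phi applied to the columns of Y. The feature
   space V is any real inner product space, possibly infinite-dimensional. *)
Definition gram (V : lmodType R) (dot : {dot V for idfun}) m N
    (phi : 'cV[R]_m -> V) (Y : 'M[R]_(m, N)) : 'M[R]_N :=
  \matrix_(i, j) dot (phi (col i Y)) (phi (col j Y)).

(* The four Penrose conditions, which determine P from A. *)
Definition moore_penrose N (A P : 'M[R]_N) : Prop :=
  [/\ A *m P *m A = A, P *m A *m P = P,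
      (A *m P)^T = A *m P & (P *m A)^T = P *m A].

Definition eigendecomposition N (A U : 'M[R]_N) (mu : 'rV[R]_N) : Prop :=
  U^T *m U = 1%:M /\ A = U *m diag_mx mu *m U^T.

Definition eig_sqrt N (U : 'M[R]_N) (mu : 'rV[R]_N) : 'M[R]_N :=
  U *m diag_mx (map_mx Num.sqrt mu) *m U^T.

(* Since 0^-1 = 0, a zero eigenvalue contributes 0: this is the inverse of
   eig_sqrt U mu when all eigenvalues are positive, and its pseudoinverse when
   they are only nonnegative. *)
Definition eig_invsqrt N (U : 'M[R]_N) (mu : 'rV[R]_N) : 'M[R]_N :=
  U *m diag_mx (map_mx (fun t => (Num.sqrt t)^-1) mu) *m U^T.

End Matrices.

Section Problems.
Variables (R : realType) (N : nat).
(* Khalf and H stand for K^{1/2} and H_K, Res for the residual matrix (written R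
   in the mathematics), lam for the multipliers lambda. *)
Variables (K Khalf H Res : 'M[R]_N) (lam : 'cV[R]_N) (nu alpha beta : R).

Definition sub_objective (a : 'cV[R]_N) (x : 'rV[R]_N) : R :=
  2^-1 * l2norm x ^+ 2 - (x *m (Res^T *m K *m a + nu *: lam)) 0 0
    + beta * l2norm x + alpha * l1norm x.

Definition sub_feasible (a : 'cV[R]_N) (b x : 'rV[R]_N) : Prop :=
  l2norm (Khalf *m a) = 1 /\ x = b *m K.

Definition sub_solution (a : 'cV[R]_N) (b x : 'rV[R]_N) : Prop :=
  sub_feasible a b x /\
  forall a' b' x', sub_feasible a' b' x' ->
    sub_objective a x <= sub_objective a' x'.

Definition dual_residual (d t1 t2 : 'cV[R]_N) : 'cV[R]_N :=
  Res^T *m Khalf *m d + nu *: lam - alpha *: t1 - beta *: t2.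

Definition minmax_objective (d t1 t2 : 'cV[R]_N) : R :=
  - (2^-1 * sqnorm_wrt H (dual_residual d t1 t2)).

Definition dual_feasible : set ('cV[R]_N * 'cV[R]_N) :=
  [set t | l2norm t.2 <= 1 /\ `|t.1| <= 1].

(* The set is nonempty and bounded above by 0 when H is positive semidefinite. *)
Definition inner_value (d : 'cV[R]_N) : R :=
  sup [set minmax_objective d t.1 t.2 | t in dual_feasible].

Definition minmax_solution (d t1 t2 : 'cV[R]_N) : Prop :=
  [/\ l2norm d = 1,
      forall d', l2norm d' = 1 -> inner_value d <= inner_value d',
      dual_feasible (t1, t2)
    & forall s, dual_feasible s ->
        minmax_objective d s.1 s.2 <= minmax_objective d t1 t2].

End Problems.

Lemma gram_sym (R : realType) (V : lmodType R) (dot : {dot V for idfun}) m N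
  (phi : 'cV[R]_m -> V) (Y : 'M[R]_(m, N)) :
  (gram dot phi Y)^T = gram dot phi Y.
Proof. by apply/matrixP => i j; rewrite !mxE hermC /= expr0 mul1r. Qed.

Lemma gram_psd (R : realType) (V : lmodType R) (dot : {dot V for idfun}) m N
  (phi : 'cV[R]_m -> V) (Y : 'M[R]_(m, N)) (v : 'cV[R]_N) :
  0 <= sqnorm_wrt (gram dot phi Y) v.
Proof.
pose w := \sum_i v i 0 *: phi (col i Y).
suff -> : sqnorm_wrt (gram dot phi Y) v = dot w w.
  have [->|w0] := eqVneq w 0; last exact/ltW/neq0_dnorm_gt0.
  by rewrite linear0r.
rewrite /sqnorm_wrt mxE /w linear_sumr /=; apply: eq_bigr => j _.
rewrite linearZr_LR /= mxE mulrC; congr (_ * _).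
rewrite linear_sumlz /=; apply: eq_bigr => i _.
by rewrite linearZl_LR /= !mxE.
Qed.

(* For singular K the vector eig_invsqrt U mu *m d satisfies
   eig_sqrt U mu *m (eig_invsqrt U mu *m d) = d only when d is in the range of
   eig_sqrt U mu; this lemma shows that invertibility removes the condition. *)
Lemma unit_eig_sqrt_range (R : realType) N (K U : 'M[R]_N) (mu : 'rV[R]_N) :
  eigendecomposition K U mu -> (forall v, 0 <= sqnorm_wrt K v) ->
  K \in unitmx -> forall d : 'cV[R]_N, exists a, d = eig_sqrt U mu *m a.
Proof.
move=> [UU KE] Kpsd Ku d.
have UUr := mulmx1C UU.
have mu0 i : 0 <= mu 0 i.
  have := Kpsd (U *m delta_mx i 0); rewrite /sqnorm_wrt KE trmx_mul !mulmxA.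
  rewrite -(mulmxA _ U^T U) UU mulmx1 -(mulmxA _ U^T U) UU mulmx1.
  rewrite trmx_delta -rowE -colE mxE mxE mxE eqxx mulr1n; exact.
exists (eig_sqrt U mu *m (invmx K *m d)).
suff KK : eig_sqrt U mu *m eig_sqrt U mu = K by rewrite mulmxA KK mulKVmx.
rewrite /eig_sqrt KE !mulmxA -(mulmxA _ U^T U) UU mulmx1 -(mulmxA U).
rewrite mulmx_diag; congr (_ *m diag_mx _ *m _).
by apply/rowP => i; rewrite !mxE -expr2 sqr_sqrtr.
Qed.

(* Main.v *)
(* For fixed d, write v = Res^T K^{1/2} d + nu lam. The inner maximum is the
   Fenchel dual of minimizing the objective over x in the range of K: weak
   duality follows from ||x|| = max <x, tau2>, ||x||_1 = max <x, tau1> and a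
   completed square, and first-order optimality of a maximizer (tau1, tau2) on
   the convex dual feasible set makes x = H_K (v - alpha tau1 - beta tau2) close
   the gap. Minimizing over d then gives the joint minimizer. A minimizing d
   exists since the inner value is lower semicontinuous on the sphere; being
   concave in K^{1/2} d, it also has a minimizer in the range of K^{1/2}. *)

Require Import Defs.
From mathcomp Require Import all_boot all_order all_algebra.
From mathcomp Require Import all_classical all_reals all_analysis.
From mathcomp Require Import finmap ring lra.

Set Implicit Arguments.
Unset Strict Implicit.
Unset Printing Implicit Defensive.

Import Order.TTheory GRing.Theory Num.Theory.
Import numFieldNormedType.Exports.

Local Open Scope ring_scope.

(** * Euclidean inner product and the dual descriptions of the two norms *)

Section InnerProduct.
Variables (R : realType) (n : nat).
Implicit Types u v w : 'cV[R]_n.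

Definition ip u v : R := (u^T *m v) 0 0.

Lemma ipE u v : ip u v = \sum_i u i 0 * v i 0.
Proof. by rewrite /ip mxE; apply: eq_bigr => i _; rewrite mxE. Qed.

Lemma ipC u v : ip u v = ip v u.
Proof. by rewrite !ipE; apply: eq_bigr => i _; rewrite mulrC. Qed.

Lemma ipDr u v w : ip u (v + w) = ip u v + ip u w.
Proof. by rewrite /ip mulmxDr mxE. Qed.

Lemma ipZr k u v : ip u (k *: v) = k * ip u v.
Proof. by rewrite /ip -scalemxAr mxE. Qed.

Lemma ipNr u v : ip u (- v) = - ip u v.
Proof. by rewrite /ip mulmxN mxE. Qed.

Lemma ipDl u v w : ip (u + v) w = ip u w + ip v w.
Proof. by rewrite ipC ipDr !(ipC w). Qed.

Lemma ipZl k u v : ip (k *: u) v = k * ip u v.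
Proof. by rewrite ipC ipZr ipC. Qed.

Lemma ipNl u v : ip (- u) v = - ip u v.
Proof. by rewrite ipC ipNr ipC. Qed.

Lemma ip_mulmxl (A : 'M[R]_n) u v : ip (A *m u) v = ip u (A^T *m v).
Proof. by rewrite /ip trmx_mul mulmxA. Qed.

Lemma ip_ge0 u : 0 <= ip u u.
Proof. by rewrite ipE; apply: sumr_ge0 => i _; rewrite -expr2 sqr_ge0. Qed.

Lemma ip_eq0 u : ip u u = 0 -> u = 0.
Proof.
move=> /eqP; rewrite ipE psumr_eq0 => [/allP u0|i _]; last first.
  by rewrite -expr2 sqr_ge0.
apply/colP => i; rewrite mxE; apply/eqP.
by have := u0 i (mem_index_enum i); rewrite /= mulf_eq0 orbb.
Qed.

Lemma l2norm_sqr u : l2norm u ^+ 2 = ip u u.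
Proof.
have -> : l2norm u = Num.sqrt (ip u u).
  rewrite /l2norm ipE; congr Num.sqrt.
  by apply: eq_bigr => i _; rewrite big_ord1.
by rewrite sqr_sqrtr ?ip_ge0.
Qed.

Lemma l2norm_ge0 p q (v : 'M[R]_(p, q)) : 0 <= l2norm v.
Proof. exact: sqrtr_ge0. Qed.

Lemma l2norm_trmx p q (v : 'M[R]_(p, q)) : l2norm v^T = l2norm v.
Proof.
rewrite /l2norm exchange_big; congr Num.sqrt.
by apply: eq_bigr => i _; apply: eq_bigr => j _; rewrite mxE.
Qed.

Lemma l1norm_trmx p q (v : 'M[R]_(p, q)) : l1norm v^T = l1norm v.
Proof.
rewrite /l1norm exchange_big.
by apply: eq_bigr => i _; apply: eq_bigr => j _; rewrite mxE.
Qed.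

Lemma l2norm_eq0 u : l2norm u = 0 -> u = 0.
Proof. by move=> u0; apply: ip_eq0; rewrite -l2norm_sqr u0 expr0n. Qed.

Lemma l2norm1P u : (l2norm u = 1) <-> (ip u u = 1).
Proof.
rewrite -l2norm_sqr; split=> [->|u1]; first by rewrite expr1n.
by apply/eqP; rewrite -(@eqrXn2 _ 2) ?l2norm_ge0 // expr1n u1.
Qed.

Lemma l2norm_le1 u : (l2norm u <= 1) = (ip u u <= 1).
Proof. by rewrite -l2norm_sqr expr_le1 ?l2norm_ge0. Qed.

Lemma sup_norm_le1P u : (`|u| <= 1) <-> (forall i, `|u i 0| <= 1).
Proof.
rewrite {1}/Num.norm /= mx_normrE; split=> [/bigmax_leP[_ u1] i|u1].
  exact: (u1 (i, 0)).
by apply/bigmax_leP; split=> // -[i j] _ /=; rewrite (ord1 j).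
Qed.

(** With [s] the norm of [u], expanding [0 <= |u - s t|^2] gives
    [2 s <u, t> <= s^2 + s^2 |t|^2 <= 2 s^2]; division by [s] leaves only [s = 0] to treat apart. *)
Lemma cauchy_schwarz_ball u t : l2norm t <= 1 -> ip u t <= l2norm u.
Proof.
rewrite l2norm_le1 => t1; have := l2norm_sqr u; have := l2norm_ge0 u.
move: (l2norm u) => s s0 us.
have [s_eq0|s_neq0] := eqVneq s 0.
  have -> : u = 0 by apply: ip_eq0; rewrite -us s_eq0 expr0n.
  by rewrite /ip trmx0 mul0mx mxE.
have s_gt0 : 0 < s by rewrite lt_def s_neq0.
have := ip_ge0 (u - s *: t).
rewrite ipDl !ipDr !ipNl !ipNr !ipZl !ipZr (ipC t u) -us => h.
rewrite -(ler_pM2l s_gt0).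
have : s * s * ip t t <= s * s by rewrite ler_piMr // mulr_ge0.
move: h; nra.
Qed.

Lemma l2norm_attained u : exists2 t, l2norm t <= 1 & ip u t = l2norm u.
Proof.
have [s0|s_neq0] := eqVneq (l2norm u) 0.
  exists 0; first by rewrite l2norm_le1 /ip mulmx0 mxE ler01.
  by rewrite s0 /ip mulmx0 mxE.
exists ((l2norm u)^-1 *: u).
  by rewrite l2norm_le1 ipZl ipZr -l2norm_sqr expr2 mulKf // mulVf.
by rewrite ipZr -l2norm_sqr expr2 mulKf.
Qed.

Lemma entry_le_l2norm u i : `|u i 0| <= l2norm u.
Proof.
rewrite -(@ler_pXn2r _ 2) ?nnegrE ?normr_ge0 ?l2norm_ge0 //.
rewrite l2norm_sqr real_normK ?num_real // ipE (bigD1 i) //= -expr2 lerDl.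
by apply: sumr_ge0 => j _; rewrite -expr2 sqr_ge0.
Qed.

Lemma ip_le_l1norm u t : `|t| <= 1 -> ip u t <= l1norm u.
Proof.
move=> /sup_norm_le1P t1; rewrite ipE /l1norm; apply: ler_sum => i _.
rewrite big_ord1 (le_trans (ler_norm _)) // normrM.
by rewrite ler_piMr.
Qed.

Lemma l1norm_attained u : exists2 t : 'cV[R]_n, `|t| <= 1 & ip u t = l1norm u.
Proof.
exists (\col_i Num.sg (u i 0)).
  apply/sup_norm_le1P => i; rewrite mxE normr_sg.
  by case: (_ != 0); rewrite //= ler01.
rewrite ipE /l1norm; apply: eq_bigr => i _.
by rewrite big_ord1 mxE mulrC -normrEsg.
Qed.

End InnerProduct.

(** * Fenchel duality for a fixed linear term *)

Section Duality.
Variables (R : realType) (N : nat) (H : 'M[R]_N) (alpha beta : R).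
Hypotheses (H_sym : H^T = H) (H_idem : H *m H = H).
Hypotheses (alpha_ge0 : 0 <= alpha) (beta_ge0 : 0 <= beta).
Implicit Types (v x : 'cV[R]_N) (t : 'cV[R]_N * 'cV[R]_N).

(** The sub-problem objective for fixed [a], with [x] turned into a column and [v] in place of
    [Res^T K a + nu lam]. *)
Definition primal v x : R :=
  2^-1 * ip x x - ip x v + beta * l2norm x + alpha * l1norm x.

Definition slack v t : 'cV[R]_N := v - alpha *: t.1 - beta *: t.2.

(** Convertible to [minmax_objective] when [v] is [Res^T *m Khalf *m d + nu *: lam]; later proofs
    exchange the two silently. *)
Definition dual v t : R := - (2^-1 * sqnorm_wrt H (slack v t)).

Lemma sqnorm_proj w : sqnorm_wrt H w = ip (H *m w) (H *m w).
Proof. by rewrite ip_mulmxl mulmxA H_sym H_idem /sqnorm_wrt /ip mulmxA. Qed.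

(** Expand [0 <= |x - H slack|^2]. Since [H x = x], the projector drops out of the cross term, and
    the pairings of [x] with [t.1] and [t.2] are bounded by the norms of [x]. *)
Lemma weak_duality v x t : H *m x = x -> dual_feasible t ->
  dual v t <= primal v x.
Proof.
move=> Hx [t2 t1]; rewrite /dual /primal sqnorm_proj.
have := ip_ge0 (x - H *m slack v t).
rewrite ipDl !ipDr !ipNl !ipNr (ipC (H *m _) x).
have -> : ip x (H *m slack v t) = ip x (slack v t).
  by rewrite -{2}Hx ip_mulmxl H_sym.
rewrite {2 3}/slack !ipDr !ipNr !ipZr => h.
have h2 := ler_wpM2l beta_ge0 (cauchy_schwarz_ball x t2).
have h1 := ler_wpM2l alpha_ge0 (ip_le_l1norm x t1).
lra.
Qed.

Lemma dual_feasible_convex (h : R) s t : 0 <= h <= 1 ->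
  dual_feasible s -> dual_feasible t ->
  dual_feasible (t.1 + h *: (s.1 - t.1), t.2 + h *: (s.2 - t.2)).
Proof.
move=> /andP[h0 h1] [s2 s1] [t2 t1]; split => /=.
  rewrite l2norm_le1; move: s2 t2; rewrite !l2norm_le1 => s2 t2.
  have := ip_ge0 (s.2 - t.2).
  rewrite !(ipDl, ipDr, ipNl, ipNr, ipZl, ipZr) (ipC t.2 s.2) => d0.
  (* The squared norm of the convex combination is [(1 - h) |t.2|^2 + h |s.2|^2 - h (1 - h) |s.2 -
     t.2|^2], so this factor gives the discarded term its sign. *)
  have k0 : 0 <= h * (1 - h) by rewrite mulr_ge0 // subr_ge0.
  have := mulr_ge0 k0 d0; have := ler_wpM2l h0 s2.
  have : (1 - h) * ip t.2 t.2 <= (1 - h) * 1 by rewrite ler_wpM2l // subr_ge0.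
  nra.
move/sup_norm_le1P: s1 => s1; move/sup_norm_le1P: t1 => t1.
apply/sup_norm_le1P => i; rewrite !mxE.
move: (s1 i) (t1 i); rewrite !ler_norml => /andP[? ?] /andP[? ?].
by apply/andP; split; nra.
Qed.

Lemma dual_maximizer_variational v s t x :
  x = H *m slack v t -> dual_feasible s -> dual_feasible t ->
  (forall s, dual_feasible s -> dual v s <= dual v t) ->
  alpha * ip x s.1 + beta * ip x s.2 <= alpha * ip x t.1 + beta * ip x t.2.
Proof.
move=> xE fs ft tmax.
have [u uE] : exists u : 'cV[R]_N,
    u = alpha *: (s.1 - t.1) + beta *: (s.2 - t.2).
  by eexists.
suff : ip x u <= 0.
  by rewrite uE !(ipDr, ipZr, ipNr); lra.
(* Moving from [t] a fraction [h] of the way to [s] cannot raise the dual value; after cancellation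
   a term linear in [h] is bounded by a quadratic one, which for small [h] forces [ip x u <= 0]. *)
have key (h : R) : 0 <= h <= 1 ->
    2 * h * ip x u <= h ^+ 2 * ip (H *m u) (H *m u).
  move=> h01; have := tmax _ (dual_feasible_convex h01 fs ft).
  rewrite /dual lerN2 ler_pM2l ?invr_gt0 // !sqnorm_proj.
  have -> : slack v (t.1 + h *: (s.1 - t.1), t.2 + h *: (s.2 - t.2)) =
            slack v t - h *: u.
    rewrite /slack uE /=; apply/colP => i; rewrite !mxE; ring.
  rewrite (mulmxDr H (slack v t)) mulmxN -scalemxAr -xE.
  have xu : ip x (H *m u) = ip x u.
    by rewrite xE !ip_mulmxl mulmxA H_sym H_idem.
  rewrite !(ipDl, ipDr, ipNl, ipNr, ipZl, ipZr) (ipC (H *m u) x) xu; lra.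
move: (ip_ge0 (H *m u)) key.
move: (ip x u) (ip (H *m u) (H *m u)) => a b b0 key.
rewrite leNgt; apply/negP => a0.
have ab0 : 0 < a + b by lra.
(* A step of length [a / (a + b)] would improve the dual value. *)
pose h := a / (a + b).
have hab : h * (a + b) = a by rewrite divfK // gt_eqF.
have h0 : 0 < h by rewrite divr_gt0.
have h1 : h <= 1 by rewrite ler_pdivrMr //; lra.
have := key h; rewrite (ltW h0) h1 => /(_ isT).
have -> : 2 * h * a = h * (2 * a) by ring.
have -> : h ^+ 2 * b = h * (h * b) by ring.
rewrite ler_pM2l //; have := mulr_gt0 h0 a0; move: hab; rewrite mulrDr; lra.
Qed.

(** The variational inequality is tested at a pair attaining both norms of [x = H slack]. This
    bounds the norm terms by the pairings of [x] with the maximizer, which is weak duality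
    reversed. *)
Lemma strong_duality v t : dual_feasible t ->
  (forall s, dual_feasible s -> dual v s <= dual v t) ->
  primal v (H *m slack v t) = dual v t.
Proof.
move=> ft tmax; apply/le_anti/andP; split; last first.
  by apply: weak_duality; rewrite // mulmxA H_idem.
have [s1 s1P s1E] := l1norm_attained (H *m slack v t).
have [s2 s2P s2E] := l2norm_attained (H *m slack v t).
have fs : dual_feasible (s1, s2) by [].
have /= := dual_maximizer_variational erefl fs ft tmax.
rewrite /primal /dual sqnorm_proj s1E s2E.
have : ip (H *m slack v t) (slack v t) = ip (H *m slack v t) (H *m slack v t).
  by rewrite [RHS]ip_mulmxl H_sym mulmxA H_idem ip_mulmxl H_sym.
move: (H *m slack v t) => x.
rewrite {1}/slack !(ipDr, ipNr, ipZr); lra.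
Qed.

End Duality.

(** * Continuity of matrix-valued maps *)

Section EntrywiseContinuity.
Variables (R : realType) (T : topologicalType).

(** Working entry by entry turns a matrix product into a finite sum of products of continuous real
    functions. *)
Definition entries_continuous p q (F : T -> 'M[R]_(p, q)) :=
  forall i j, continuous (fun x => F x i j).

Lemma continuous_bigsum (I : Type) (r : seq I) (f : I -> T -> R) :
  (forall i, continuous (f i)) -> continuous (fun x => \sum_(i <- r) f i x).
Proof.
move=> fc; elim: r => [|i r ih].
  by under eq_fun do rewrite big_nil; move=> x; exact: cvg_cst.
under eq_fun do rewrite big_cons.
by move=> x; apply: cvgD; [exact: fc|exact: ih].
Qed.

Lemma entries_continuous_cst p q (A : 'M[R]_(p, q)) :
  entries_continuous (fun=> A).
Proof. by move=> i j x; exact: cvg_cst. Qed.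

Lemma entries_continuousD p q (F G : T -> 'M[R]_(p, q)) :
  entries_continuous F -> entries_continuous G ->
  entries_continuous (fun x => F x + G x).
Proof.
move=> Fc Gc i j; under eq_fun do rewrite mxE.
by move=> x; apply: cvgD; [exact: Fc|exact: Gc].
Qed.

Lemma entries_continuousN p q (F : T -> 'M[R]_(p, q)) :
  entries_continuous F -> entries_continuous (fun x => - F x).
Proof.
move=> Fc i j; under eq_fun do rewrite mxE.
by move=> x; apply: cvgN; exact: Fc.
Qed.

Lemma entries_continuousZ p q k (F : T -> 'M[R]_(p, q)) :
  entries_continuous F -> entries_continuous (fun x => k *: F x).
Proof.
move=> Fc i j; under eq_fun do rewrite mxE.
by move=> x; apply: cvgM; [exact: cvg_cst|exact: Fc].
Qed.

Lemma entries_continuous_trmx p q (F : T -> 'M[R]_(p, q)) :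
  entries_continuous F -> entries_continuous (fun x => (F x)^T).
Proof.
by move=> Fc i j; under eq_fun do rewrite mxE; exact: Fc.
Qed.

Lemma entries_continuousM p q r
    (F : T -> 'M[R]_(p, q)) (G : T -> 'M[R]_(q, r)) :
  entries_continuous F -> entries_continuous G ->
  entries_continuous (fun x => F x *m G x).
Proof.
move=> Fc Gc i j; under eq_fun do rewrite mxE.
apply: continuous_bigsum => k x.
by apply: cvgM; [exact: Fc|exact: Gc].
Qed.

End EntrywiseContinuity.

(** * Minimization on compact sets *)

Section Compactness.
Local Open Scope classical_set_scope.
Local Open Scope ring_scope.
Variable R : realType.

Lemma entries_continuous_id p q : entries_continuous (@id 'M[R]_(p, q)).
Proof. by move=> i j; exact: coord_continuous. Qed.

(** Without a minimizer, the open sets [g y < g x], indexed by [y] in [S], cover [S]. In a finite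
    subcover the index with least [g] would be covered by an index with smaller [g]. *)
Lemma lsc_compact_min (T : ptopologicalType) (S : set T) (g : T -> R) :
  S !=set0 -> compact S -> (forall c, open [set x | c < g x]) ->
  exists2 x, S x & forall y, S y -> g x <= g y.
Proof.
move=> [s0 Ss0] cS go; apply: contrapT => nomin.
have lower x : S x -> exists2 y, S y & g y < g x.
  move=> Sx; apply: contrapT => nolower; apply: nomin; exists x => // y Sy.
  by rewrite leNgt; apply/negP => yx; apply: nolower; exists y.
move: cS; rewrite compact_cover => /(_ T S (fun y => [set x | g y < g x])).
case=> [y _|x Sx|D DS Dcov].
- exact: go.
- by have [y Sy yx] := lower x Sx; exists y.
have [i0 Di0 _] := Dcov _ Ss0.
have [y _ ymin] := @arg_minP _ R D [` Di0]%fset xpredT (fun i => g (val i)) isT.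
have /set_mem Sy := DS _ (valP y).
have [j Dj jy] := Dcov _ Sy.
by have := ymin [` Dj]%fset isT; rewrite leNgt jy.
Qed.

Lemma compact_rV_of_bound n (A : set 'rV[R]_n) :
  (forall v, A v -> forall i, `|v 0 i| <= 1) -> closed A -> compact A.
Proof.
move=> A1 Acl.
have cube : compact [set v : 'rV[R]_n | forall i, v ord0 i \in `[-1, 1]].
  apply: (@rV_compact R n (fun=> `[-1, 1]%classic)) => _.
  exact: segment_compact.
apply: subclosed_compact Acl cube _ => v Av i /=.
by rewrite in_itv /= -ler_norml; exact: A1.
Qed.

End Compactness.

(** * Existence of the inner maximum *)

Section InnerMaximum.
Local Open Scope classical_set_scope.
Local Open Scope ring_scope.
Variables (R : realType) (N : nat) (H : 'M[R]_N) (alpha beta : R).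

(** Both multipliers are packed into a single row vector, so that the compactness of cubes of row
    vectors applies to pairs. *)
Let pair_of (r : 'rV[R]_(N + N)) : 'cV[R]_N * 'cV[R]_N :=
  ((lsubmx r)^T, (rsubmx r)^T).

Let pair_of_continuous : entries_continuous (fun r => (pair_of r).1) /\
  entries_continuous (fun r => (pair_of r).2).
Proof.
split=> i j; rewrite /pair_of /=; under eq_fun do rewrite !mxE;
  exact: coord_continuous.
Qed.

Lemma ip_continuous (T : topologicalType) (F G : T -> 'cV[R]_N) :
  entries_continuous F -> entries_continuous G ->
  continuous (fun x => ip (F x) (G x)).
Proof.
move=> Fc Gc.
suff h : entries_continuous (fun x => (F x)^T *m G x) by exact: h.
by apply: entries_continuousM => //; exact: entries_continuous_trmx.
Qed.

Lemma dual_continuous (T : topologicalType) (v : T -> 'cV[R]_N)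
    (t1 t2 : T -> 'cV[R]_N) :
  entries_continuous v -> entries_continuous t1 -> entries_continuous t2 ->
  continuous (fun x => dual H alpha beta (v x) (t1 x, t2 x)).
Proof.
move=> vc t1c t2c.
have sc : entries_continuous (fun x => slack alpha beta (v x) (t1 x, t2 x)).
  by do !apply: entries_continuousD => //; apply: entries_continuousN;
     apply: entries_continuousZ.
move=> x; apply: cvgN; apply: cvgM; first exact: cvg_cst.
pose w x := slack alpha beta (v x) (t1 x, t2 x).
suff h : entries_continuous (fun x => (w x)^T *m H *m w x) by exact: h.
apply: entries_continuousM => //; apply: entries_continuousM.
  exact: entries_continuous_trmx.
exact: entries_continuous_cst.
Qed.

Lemma dual_max_exists v : exists2 t, dual_feasible t &
  forall s, dual_feasible s -> dual H alpha beta v s <= dual H alpha beta v t.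
Proof.
have [p1c p2c] := pair_of_continuous.
pose A : set 'rV[R]_(N + N) := [set r | dual_feasible (pair_of r)].
have pairK s : pair_of (row_mx s.1^T s.2^T) = s.
  by case: s => s1 s2; rewrite /pair_of row_mxKl row_mxKr !trmxK.
have A0 : A !=set0.
  exists (row_mx (0 : 'cV[R]_N)^T (0 : 'cV[R]_N)^T).
  rewrite /A /= (pairK (0, 0)); split => /=; last by rewrite normr0 ler01.
  by rewrite l2norm_le1 /ip mulmx0 mxE ler01.
have Acl : closed A.
  (* Each constraint becomes a closed condition on a continuous real function: the squared norm for
     the ball, one absolute value per entry for the cube. *)
  have -> : A = ([set r | (ip (pair_of r).2 (pair_of r).2 <= 1)%R] `&`
      \bigcap_(i in setT) [set r | `|(pair_of r).1 i 0| <= 1]).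
    apply/seteqP; split=> r /=.
      move=> [r2 /sup_norm_le1P r1]; rewrite -l2norm_le1; split=> // i _.
      exact: r1.
    move=> [r2 r1]; split; first by rewrite l2norm_le1.
    by apply/sup_norm_le1P => i; exact: r1.
  apply: closedI.
    have pc := ip_continuous p2c p2c.
    by apply: (preimage_closed _ (@closed_le R 1)) => r _; exact: pc.
  apply: closed_bigI => i _.
  apply: (@preimage_closed _ _ (fun r => `|(pair_of r).1 i 0|)
    _ _ (@closed_le R 1)).
  by move=> r _; exact: (cvg_norm (p1c i 0 r)).
have Ac : compact A.
  apply: compact_rV_of_bound Acl => r [r2 /sup_norm_le1P r1] i.
  rewrite -(hsubmxK r); case: (splitP i) => j ij.
    have -> : i = lshift N j by exact: val_inj.
    by rewrite row_mxEl; have := r1 j; rewrite mxE.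
  have -> : i = rshift N j by exact: val_inj.
  rewrite row_mxEr; apply: le_trans r2.
  by have := entry_le_l2norm (rsubmx r)^T j; rewrite mxE.
have fc : continuous (fun r => dual H alpha beta v (pair_of r)).
  by apply: dual_continuous => //; exact: entries_continuous_cst.
have [r /set_mem rA rmax] := EVT_max_rV A0 Ac (continuous_subspaceT fc).
exists (pair_of r) => // s fs.
have sA : row_mx s.1^T s.2^T \in A by apply/mem_set; rewrite /A /= pairK.
by have := rmax _ sA; rewrite pairK.
Qed.

End InnerMaximum.

(** * The outer minimum over the unit sphere *)

Section MinMax.
Local Open Scope classical_set_scope.
Local Open Scope ring_scope.
Variables (R : realType) (N : nat) (Khalf H Z Res : 'M[R]_N) (lam : 'cV[R]_N).
Variables (nu alpha beta : R).
Hypotheses (H_sym : H^T = H) (H_idem : H *m H = H).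
Hypotheses (KhalfH : Khalf *m H = Khalf) (H_range : H = Khalf *m Z).
Hypotheses (alpha_ge0 : 0 <= alpha) (beta_ge0 : 0 <= beta).
Implicit Types (d x : 'cV[R]_N) (t : 'cV[R]_N * 'cV[R]_N).

Let lin d : 'cV[R]_N := Res^T *m Khalf *m d + nu *: lam.
Let value := inner_value Khalf H Res lam nu alpha beta.
Let max_at d t := dual_feasible t /\
  forall s, dual_feasible s ->
    dual H alpha beta (lin d) s <= dual H alpha beta (lin d) t.

(** The maximizer shows that the set of values is nonempty and bounded above, so [sup] is a genuine
    supremum. *)
Lemma inner_value_attained d t : max_at d t ->
  value d = dual H alpha beta (lin d) t.
Proof.
move=> [ft tmax]; apply/le_anti/andP; split.
  apply: ge_sup; first by exists (dual H alpha beta (lin d) t), t.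
  by move=> _ [s fs <-]; exact: tmax.
apply: ub_le_sup; last by exists t.
by exists (dual H alpha beta (lin d) t) => _ [s fs <-]; exact: tmax.
Qed.

Lemma dual_le_inner_value d t : dual_feasible t ->
  dual H alpha beta (lin d) t <= value d.
Proof.
move=> ft; have [s fs smax] := dual_max_exists H alpha beta (lin d).
by rewrite (@inner_value_attained d s) //; exact: smax.
Qed.

Lemma inner_value_le_primal d x : H *m x = x ->
  value d <= primal alpha beta (lin d) x.
Proof.
move=> Hx; have [s fs smax] := dual_max_exists H alpha beta (lin d).
by rewrite (@inner_value_attained d s) //; exact: weak_duality.
Qed.

(** Together with [inner_value_le_primal], this presents the inner value as a minimum over [x] of
    functions affine in [d], hence as a concave function. *)
Lemma inner_value_primal d : exists2 x, H *m x = x &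
  value d = primal alpha beta (lin d) x.
Proof.
have [s fs smax] := dual_max_exists H alpha beta (lin d).
exists (H *m slack alpha beta (lin d) s); first by rewrite mulmxA H_idem.
by rewrite (@inner_value_attained d s) // strong_duality.
Qed.

(* [inner_value] is concave and factors through [H *m d], which lies on a
   segment joining opposite unit vectors in the range of [Khalf]; an endpoint
   does no worse. *)
Lemma range_unit_vector_no_worse d : Khalf != 0 -> l2norm d = 1 ->
  exists u, [/\ l2norm u = 1, exists a : 'cV[R]_N, u = Khalf *m a
    & value u <= value d].
Proof.
move=> Kh0 /l2norm1P d1.
have p_le1 : ip (H *m d) (H *m d) <= 1.
  have := ip_ge0 (d - H *m d).
  have HdE : ip (H *m d) (H *m d) = ip d (H *m d).
    by rewrite ip_mulmxl mulmxA H_sym H_idem.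
  rewrite ipDl !ipDr !ipNl !ipNr (ipC (H *m d) d) HdE d1; lra.
(* If [H d] is nonzero, it is itself in the range of [Khalf] and [k = 1]; if it vanishes, any
   nonzero column of [Khalf] gives a direction, with [k = 0]. *)
have [w [k [w0 HdE ks]]] : exists (w : 'cV[R]_N) k, [/\ Khalf *m w != 0,
    H *m d = k *: (Khalf *m w) & 0 <= k * l2norm (Khalf *m w) <= 1].
  have [Hd0|Hd_neq0] := eqVneq (H *m d) 0; last first.
    exists (Z *m d), 1; rewrite scale1r mul1r mulmxA -H_range.
    by rewrite l2norm_ge0 l2norm_le1.
  suff [j Kj] : exists j, Khalf *m delta_mx j (0 : 'I_1) != 0.
    by exists (delta_mx j 0), 0; rewrite scale0r mul0r lexx ler01.
  apply: contrapT => Kj; case/negP: Kh0; apply/eqP/matrixP => i j; rewrite mxE.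
  have : Khalf *m delta_mx j (0 : 'I_1) = 0.
    by apply/eqP; apply: contrapT => /negP Kj0; apply: Kj; exists j.
  by rewrite -colE => /colP/(_ i); rewrite !mxE.
have s0 : l2norm (Khalf *m w) != 0 by apply: contra w0 => /eqP/l2norm_eq0 ->.
pose u := (l2norm (Khalf *m w))^-1 *: (Khalf *m w).
pose a := (l2norm (Khalf *m w))^-1 *: w.
have uE : u = Khalf *m a by rewrite /u /a scalemxAr.
have u1 : l2norm u = 1.
  by apply/l2norm1P; rewrite ipZl ipZr -l2norm_sqr expr2 mulKf // mulVf.
move: ks; set theta := k * _ => /andP[th0 th1].
have dE : H *m d = theta *: u by rewrite scalerA mulfK.
(* With the [x] optimal for [d] frozen, the objective is affine along the segment from [- u] to [u],
   where [H d] sits at [theta] in [[0, 1]]. The sign of the slope decides which endpoint to take. *)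
have [x Hx dx] := inner_value_primal d.
pose c := primal alpha beta (nu *: lam) x.
have primalE e : primal alpha beta (lin e) x = c - ip x (Res^T *m Khalf *m e).
  by rewrite /c /primal /lin ipDr; ring.
have linE : ip x (Res^T *m Khalf *m d) = theta * ip x (Res^T *m Khalf *m u).
  by rewrite -ipZr scalemxAr -dE !mulmxA -(mulmxA Res^T Khalf H) KhalfH.
have [l0|l0] := leP 0 (ip x (Res^T *m Khalf *m u)).
  exists u; split => //; first by exists a.
  rewrite dx (le_trans (inner_value_le_primal u Hx)) // !primalE linE; nra.
exists (- u); split.
- by apply/l2norm1P; rewrite ipNl ipNr opprK; apply/l2norm1P.
- by exists (- a); rewrite uE mulmxN.
rewrite dx (le_trans (inner_value_le_primal (- u) Hx)) // !primalE linE.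
rewrite mulmxN ipNr; nra.
Qed.

(** Freezing the maximizer found at [r] gives a continuous lower bound of [value] that is exact at
    [r], so it stays above [c] nearby. *)
Lemma inner_value_lsc c : open [set r : 'rV[R]_N | c < value r^T].
Proof.
rewrite openE => r /= cr; rewrite /interior /=.
have [s fs smax] := dual_max_exists H alpha beta (lin r^T).
pose f (q : 'rV[R]_N) := dual H alpha beta (lin q^T) (s.1, s.2).
have fc : continuous f.
  apply: dual_continuous; try exact: entries_continuous_cst.
  apply: entries_continuousD; last exact: entries_continuous_cst.
  apply: entries_continuousM; first exact: entries_continuous_cst.
  by apply: entries_continuous_trmx; exact: entries_continuous_id.
have cf : c < f r.
  by move: cr; rewrite (@inner_value_attained r^T s) // /f -surjective_pairing.
apply: filterS (cvgr_gt (f r) (fc r) c cf) => q /= /lt_le_trans; apply.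
by rewrite /f -surjective_pairing; exact: dual_le_inner_value.
Qed.

Lemma sphere_compact : compact [set r : 'rV[R]_N | l2norm r = 1].
Proof.
apply: compact_rV_of_bound.
  move=> r r1 i; have := entry_le_l2norm r^T i.
  by rewrite l2norm_trmx mxE r1.
have -> : [set r : 'rV[R]_N | l2norm r = 1] =
    (fun r : 'rV[R]_N => ip r^T r^T) @^-1` [set y | y = 1].
  apply/seteqP; split=> r /=; first by rewrite -l2norm_trmx => /l2norm1P.
  by move=> /l2norm1P; rewrite l2norm_trmx.
have tc : entries_continuous (fun r : 'rV[R]_N => r^T).
  by apply: entries_continuous_trmx; exact: entries_continuous_id.
have pc := ip_continuous tc tc.
by apply: (preimage_closed _ (@closed_eq R 1)) => r _; exact: pc.
Qed.

Lemma minmax_solution_exists : Khalf != 0 -> exists d t1 t2 : 'cV[R]_N,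
  minmax_solution Khalf H Res lam nu alpha beta d t1 t2 /\
  (exists a : 'cV[R]_N, d = Khalf *m a).
Proof.
move=> Kh0.
have S0 : [set r : 'rV[R]_N | l2norm r = 1] !=set0.
  (* A nonzero [Khalf] forces [N] to be positive; for [N = 0] the sphere is empty. *)
  have [i _] : exists i : 'I_N, True.
    apply: contrapT => noi; case/negP: Kh0; apply/eqP/matrixP => i.
    by case: noi; exists i.
  exists (delta_mx i 0)^T => /=; rewrite l2norm_trmx; apply/l2norm1P.
  by rewrite /ip trmx_delta mul_delta_mx mxE !eqxx.
have [r r1 rmin] := lsc_compact_min S0 sphere_compact inner_value_lsc.
have rT1 : l2norm r^T = 1 by rewrite l2norm_trmx.
have [u [u1 ua ur]] := range_unit_vector_no_worse Kh0 rT1.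
have [s fs smax] := dual_max_exists H alpha beta (lin u).
exists u, s.1, s.2; split=> //; rewrite (surjective_pairing s) in fs smax.
split=> // d d1; apply: le_trans ur _.
by rewrite -(trmxK d); apply: rmin; rewrite /= l2norm_trmx.
Qed.

End MinMax.

(** * Pseudoinverse and square root of the kernel matrix *)

Section Kernel.
Variables (R : realType) (N : nat).
Implicit Types (K U A P : 'M[R]_N) (mu : 'rV[R]_N).

(** Transposing [K P K = K] gives [P K K = K] and [K K P = K], so both products equal [P K K P]. *)
Lemma moore_penrose_comm K P : K^T = K -> moore_penrose K P ->
  K *m P = P *m K.
Proof.
move=> Ks [KPK PKP HT ET].
have EK : P *m K *m K = K by rewrite -[LHS]trmxK trmx_mul ET Ks mulmxA KPK Ks.
have KH : K *m (K *m P) = K by rewrite -[LHS]trmxK trmx_mul HT Ks KPK Ks.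
by rewrite -{1}EK -!mulmxA KH.
Qed.

(** The diagonal entries of [A A^T] are the squared norms of the rows of [A]. *)
Lemma mulmx_tr_eq0 A : A *m A^T = 0 -> A = 0.
Proof.
move=> AA; apply/matrixP => i j; rewrite mxE.
have := ip_eq0 (u := (row i A)^T); rewrite /ip trmxK.
have -> : (row i A *m (row i A)^T) 0 0 = (A *m A^T) i i.
  by rewrite !mxE; apply: eq_bigr => k _; rewrite !mxE.
by rewrite AA mxE => /(_ erefl)/colP/(_ j); rewrite !mxE.
Qed.

Lemma eig_sqrt_sym U mu : (eig_sqrt U mu)^T = eig_sqrt U mu.
Proof. by rewrite /eig_sqrt !trmx_mul trmxK tr_diag_mx mulmxA. Qed.

Lemma eig_sqrt_invsqrt U mu : U^T *m U = 1%:M ->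
  eig_sqrt U mu *m eig_invsqrt U mu *m eig_sqrt U mu = eig_sqrt U mu.
Proof.
move=> UU; rewrite /eig_sqrt /eig_invsqrt !mulmxA.
do 2 rewrite -(mulmxA _ U^T U) UU mulmx1.
rewrite -2!(mulmxA U) !mulmx_diag; congr (_ *m diag_mx _ *m _).
apply/rowP => i; rewrite !mxE.
(* The identity [s s^-1 s = s] survives at [s = 0] because [0^-1 = 0]. *)
by have [->|s0] := eqVneq (Num.sqrt (mu 0 i)) 0; rewrite ?mulr0 // divff ?mul1r.
Qed.

Lemma eigenvalue_ge0 K U mu : eigendecomposition K U mu ->
  (forall v, 0 <= sqnorm_wrt K v) -> forall i, 0 <= mu 0 i.
Proof.
move=> [UU KE] Kpsd i.
(* At the [i]-th eigenvector the quadratic form takes the value [mu 0 i]. *)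
have := Kpsd (U *m delta_mx i 0); rewrite /sqnorm_wrt KE trmx_mul !mulmxA.
do 2 rewrite -(mulmxA _ U^T U) UU mulmx1.
by rewrite trmx_delta -rowE -colE !mxE eqxx mulr1n.
Qed.

Lemma eig_sqrt_sqr K U mu : eigendecomposition K U mu ->
  (forall v, 0 <= sqnorm_wrt K v) -> eig_sqrt U mu *m eig_sqrt U mu = K.
Proof.
move=> Keig Kpsd; have mu0 := eigenvalue_ge0 Keig Kpsd.
case: Keig => UU ->; rewrite /eig_sqrt !mulmxA -(mulmxA _ U^T U) UU mulmx1.
rewrite -(mulmxA U) mulmx_diag; congr (_ *m diag_mx _ *m _).
by apply/rowP => i; rewrite !mxE -expr2 sqr_sqrtr.
Qed.

(** Writing [K a] as [Khalf (Khalf a)] shows that the atom enters only through the unit vector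
    [d = Khalf a] of the min-max problem. *)
Lemma sub_objective_primal K Khalf Res lam nu alpha beta (a : 'cV[R]_N)
    (x : 'rV[R]_N) : K = Khalf *m Khalf ->
  sub_objective K Res lam nu alpha beta a x =
  primal alpha beta (Res^T *m Khalf *m (Khalf *m a) + nu *: lam) x^T.
Proof.
move=> ->; rewrite /sub_objective /primal l2norm_trmx l1norm_trmx -l2norm_sqr.
by rewrite l2norm_trmx /ip trmxK !mulmxA.
Qed.

End Kernel.

Theorem corollary7 (R : realType) (V : lmodType R) (dot : {dot V for idfun})
  (m N : nat) (phi : 'cV[R]_m -> V) (Y : 'M[R]_(m, N))
  (K Kdag U Res : 'M[R]_N) (mu : 'rV[R]_N)
  (lam : 'cV[R]_N) (nu alpha beta : R)
  (K_gram : K = gram dot phi Y)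
  (Kdag_mp : moore_penrose K Kdag)
  (K_eig : eigendecomposition K U mu)
  (lam_ge0 : forall i, 0 <= lam i 0)
  (alpha_ge0 : 0 <= alpha) (beta_ge0 : 0 <= beta) :
  let Khalf := eig_sqrt U mu in
  let Kinvhalf := eig_invsqrt U mu in
  let H := K *m Kdag in
  [/\ H = Kdag *m K,
      K != 0 -> exists d t1 t2 : 'cV[R]_N,
        minmax_solution Khalf H Res lam nu alpha beta d t1 t2 /\
        (exists a : 'cV[R]_N, d = Khalf *m a)
    & forall d t1 t2 : 'cV[R]_N,
        minmax_solution Khalf H Res lam nu alpha beta d t1 t2 ->
        (exists a : 'cV[R]_N, d = Khalf *m a) ->
        let a := Kinvhalf *m d in
        let c := Res^T *m Khalf *m d + nu *: lam - beta *: t2 - alpha *: t1 in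
        let b := c^T *m Kdag in
        let x := c^T *m H in
        sub_solution K Khalf Res lam nu alpha beta a b x /\ x = b *m K].
Proof.
move=> Khalf Kinvhalf H.
have K_sym : K^T = K by rewrite K_gram gram_sym.
have K_psd v : 0 <= sqnorm_wrt K v by rewrite K_gram gram_psd.
have HE : H = Kdag *m K := moore_penrose_comm K_sym Kdag_mp.
have Khalf_sym : Khalf^T = Khalf := eig_sqrt_sym U mu.
have KhalfK : Khalf *m Khalf = K := eig_sqrt_sqr K_eig K_psd.
have Khalf_pinv : Khalf *m Kinvhalf *m Khalf = Khalf.
  by apply: eig_sqrt_invsqrt; case: K_eig.
have [KPK _ H_sym _] := Kdag_mp; rewrite -/H in H_sym KPK.
have H_idem : H *m H = H by rewrite {2}/H mulmxA KPK.
have KH : K *m H = K by rewrite HE mulmxA.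
have H_range : H = Khalf *m (Khalf *m Kdag) by rewrite mulmxA KhalfK.
clearbody Khalf Kinvhalf H.
have HKhalf : H *m Khalf = Khalf.
  (* For [A = H Khalf - Khalf], the product [A A^T] is [H K H - H K - K H + K], which vanishes since
     [H K = K H = K]. *)
  apply/eqP; rewrite -subr_eq0; apply/eqP/mulmx_tr_eq0.
  rewrite linearB /= trmx_mul Khalf_sym H_sym mulmxBl !mulmxBr !mulmxA.
  by rewrite -(mulmxA H Khalf Khalf) KhalfK KPK KH !subrr.
have KhalfH : Khalf *m H = Khalf.
  by rewrite -{1}Khalf_sym -{1}H_sym -trmx_mul HKhalf.
split => //.
  move=> K0.
  apply: (minmax_solution_exists _ _ _ H_sym H_idem KhalfH H_range) => //.
  by apply: contra K0 => /eqP Kh0; rewrite -KhalfK Kh0 mul0mx.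
move=> d t1 t2 [d1 dmin ft tmax] [a0 da0] a c b x.
have xbK : x = b *m K by rewrite /x /b HE mulmxA.
(* The range condition on [d] is what makes [a] feasible when [K] is singular. *)
have ad : Khalf *m a = d by rewrite /a da0 !mulmxA Khalf_pinv.
have cE : c = slack alpha beta (Res^T *m Khalf *m d + nu *: lam) (t1, t2).
  by rewrite /c /slack addrAC.
split=> //; split; first by split; rewrite // ad.
move=> a' b' x' [a'1 x'E].
(* The objective at [(a, x)] equals the dual value at [d], thus the inner value there. This is at
   most the inner value at [Khalf a'], which weak duality bounds by the objective at [(a', x')]. *)
rewrite !(sub_objective_primal _ _ _ _ _ _ _ (esym KhalfK)) ad.
have -> : x^T = H *m c by rewrite /x trmx_mul trmxK H_sym.
rewrite cE (strong_duality H_sym H_idem alpha_ge0 beta_ge0 ft tmax).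
rewrite -(inner_value_attained (conj ft tmax)) (le_trans (dmin _ a'1)) //.
apply: inner_value_le_primal => //.
by rewrite x'E trmx_mul K_sym mulmxA KPK.
Qed.
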